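(* Let $n\geq 1$, let $Q_{n-1}$ be a polynomial of degree at most $n-1$ satisfying conditions (i) and (ii) of the context, with coefficients $\gamma_{n-1,k}$ and nodes $x_{n,k}$, and let $R_n$ be the associated rational Bernstein operator. Then for every integer $s\geq 1$ and every $x\in[0,1]$, with $e_s(x)=x^s$, $$R_n(e_s)(x)-x^s=\frac{x(1-x)}{Q_{n-1}(x)}\sum_{l=0}^{s-2}x^l\sum_{k=0}^{n-1}\gamma_{n-1,k}\left(x_{n,k+1}^{\,s-1-l}-x_{n,k}^{\,s-1-l}\right)x^k(1-x)^{n-1-k}.$$
   Context: $C[0,1]$ is the space of continuous real-valued functions on $[0,1]$. Let $n\geq 1$ and let $Q_{n-1}$ be a polynomial of degree at most $n-1$, strictly positive on $[0,1]$. Write $Q_{n-1}(x)=\sum_{k=0}^{n-1}\gamma_{n-1,k}\,x^k(1-x)^{n-1-k}$ and $\gamma_{n-1,k}=w_{n-1,k}\binom{n-1}{k}$, so that the $w_{n-1,k}$ are the Bernstein coefficients of $Q_{n-1}$. Conditions: (i) $w_{n-1,k}>0$ for $k=0,\dots,n-1$; (ii) property (W): $\frac{w_{n-1,k-1}w_{n-1,k+1}}{w_{n-1,k}^2}<\frac{k+1}{k}\cdot\frac{n-k}{n-k-1}$ for $k=1,\dots,n-2$ (equivalently, $\gamma_{n-1,k-1}/\gamma_{n-1,k}$ is strictly increasing in $k=1,\dots,n-1$). Convention: $\gamma_{n-1,-1}=\gamma_{n-1,n}=0$. The nodes are $x_{n,k}=\frac{\gamma_{n-1,k-1}}{\gamma_{n-1,k}+\gamma_{n-1,k-1}}$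 for $k=0,\dots,n$; under (i) and (ii) one has $0=x_{n,0}<x_{n,1}<\dots<x_{n,n}=1$. The rational Bernstein operator associated with $Q_{n-1}$ is $$R_nf(x)=\sum_{k=0}^{n}f(x_{n,k})\,(\gamma_{n-1,k}+\gamma_{n-1,k-1})\,\frac{x^k(1-x)^{n-k}}{Q_{n-1}(x)},\qquad f\in C[0,1],$$ which reproduces the functions $1$ and $x$. An empty sum (the case $s=1$) equals $0$, and $x^0=1$. *)

(* Defs.v *)
From HB Require Import structures.
From mathcomp Require Import all_boot all_order all_algebra.
From mathcomp Require Import reals.

Set Implicit Arguments.
Unset Strict Implicit.
Unset Printing Implicit Defensive.

Import Order.TTheory GRing.Theory Num.Theory.
Local Open Scope ring_scope.

Section RationalBernstein.
Variable R : realType.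

(* Sequences w : nat -> R stand for families w_{n-1,0}, ..., w_{n-1,n-1};
   values w k with k >= n do not affect anything below (n >= 1). *)

(* w k * 'C(n-1, k); for n >= 1 the binomial vanishes at k = n, which gives
   the convention gamma_{n-1,n} = 0. *)
Definition bgamma (n : nat) (w : nat -> R) (k : nat) : R :=
  w k * 'C(n.-1, k)%:R.

(* gamma_{n-1,k-1}, including the convention gamma_{n-1,-1} = 0. *)
Definition bgamma_pred (n : nat) (w : nat -> R) (k : nat) : R :=
  if k is j.+1 then bgamma n w j else 0.

(* The Bernstein polynomials of degree n-1 are a basis of the polynomials of
   degree at most n-1, so this determines w 0, ..., w (n-1) from Q. *)
Definition bernstein_coefs (n : nat) (Q : {poly R}) (w : nat -> R) : Prop :=
  Q = \sum_(k < n) bgamma n w k *: ('X^k * (1 - 'X) ^+ (n.-1 - k)).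

Definition property_W (n : nat) (w : nat -> R) : Prop :=
  forall k : nat, (1 <= k)%N -> (k.+2 <= n)%N ->
    w k.-1 * w k.+1 / w k ^+ 2
      < (k.+1%:R / k%:R) * ((n - k)%:R / (n - k - 1)%:R).

Definition bnode (n : nat) (w : nat -> R) (k : nat) : R :=
  bgamma_pred n w k / (bgamma n w k + bgamma_pred n w k).

(* Only the values of f at the nodes, which lie in [0, 1], are used; an element
   of C[0,1] is represented by any function R -> R extending it. *)
Definition rational_bernstein (n : nat) (Q : {poly R}) (w : nat -> R)
    (f : R -> R) (x : R) : R :=
  \sum_(k < n.+1) f (bnode n w k) * (bgamma n w k + bgamma_pred n w k)
    * (x ^+ k * (1 - x) ^+ (n - k) / Q.[x]).

End RationalBernstein.

(* Main.v *)
Require Import Defs.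
From HB Require Import structures.
From mathcomp Require Import all_boot all_order all_algebra.
From mathcomp Require Import reals ring.

(** The nodes are chosen so that [x_{n,k} (gamma_k + gamma_{k-1}) = gamma_{k-1}].
    Hence, writing [B_k = x^k (1-x)^(n-1-k)] and shifting the index by one,
    [Q * R_n(e_1 f) = x * sum_k gamma_k f(x_{n,k+1}) B_k], whereas splitting the
    weight [gamma_k + gamma_{k-1}] into its two parts gives
    [Q * R_n f = (1-x) * sum_k gamma_k f(x_{n,k}) B_k
               + x * sum_k gamma_k f(x_{n,k+1}) B_k].
    Subtracting [x] times the second identity from the first measures how far
    [R_n] is from commuting with multiplication by the variable:
    [R_n(e_1 f) - x R_n f
       = x(1-x)/Q * sum_k gamma_k (f(x_{n,k+1}) - f(x_{n,k})) B_k]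
    (lemma [rational_bernstein_commutator]).  For [f = e_m] this is a first-order
    linear recurrence in [m] for the moments [R_n(e_m)(x)], with initial value
    [R_n(e_0) = 1] (lemma [rational_bernstein_one]).  Unrolling it yields
    [R_n(e_s) - x^s] as the sum over [l] of [x^l] times the commutator for
    [f = e_(s-1-l)]; the last term, [f = e_0], vanishes because a constant has no
    increments, which is why the outer sum stops at [l = s-2]. *)

Set Implicit Arguments.
Unset Strict Implicit.
Unset Printing Implicit Defensive.

Import Order.TTheory GRing.Theory Num.Theory.
Local Open Scope ring_scope.

Lemma bgamma_last (R : realType) (n : nat) (w : nat -> R) :
  (1 <= n)%N -> bgamma n w n = 0.
Proof. by case: n => // n _; rewrite /bgamma /= bin_small // mulr0. Qed.

Lemma bgamma_gt0 (R : realType) (n : nat) (w : nat -> R) (k : nat) :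
  (forall j : nat, (j < n)%N -> 0 < w j) -> (k < n)%N -> 0 < bgamma n w k.
Proof.
by case: n => // n wpos lekn; rewrite mulr_gt0 ?wpos // ltr0n bin_gt0.
Qed.

Lemma bnode_weight (R : realType) (n : nat) (w : nat -> R) (k : nat) :
  (1 <= n)%N -> (forall j : nat, (j < n)%N -> 0 < w j) -> (k <= n)%N ->
  bnode n w k * (bgamma n w k + bgamma_pred n w k) = bgamma_pred n w k.
Proof.
move=> n_gt0 wpos lekn; rewrite divfK // gt_eqF //.
have pred_ge0 : 0 <= bgamma_pred n w k.
  by case: k lekn => //= k ltkn; exact/ltW/bgamma_gt0.
move: lekn; rewrite leq_eqVlt => /predU1P[-> | ltkn].
(* At the last index only the predecessor weight survives. *)
  rewrite bgamma_last // add0r; case: n n_gt0 wpos {pred_ge0} => //= n _ wpos.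
  exact: bgamma_gt0.
by rewrite ltr_wpDr // bgamma_gt0.
Qed.

(** The two boundary conventions make the index shift exact: the term [k = 0]
    vanishes, so no correction appears. *)
Lemma sum_bgamma_pred (R : realType) (n : nat) (w : nat -> R) (f : nat -> R)
    (x : R) : (1 <= n)%N ->
  \sum_(k < n.+1) f k * bgamma_pred n w k * (x ^+ k * (1 - x) ^+ (n - k)) =
  x * \sum_(k < n) bgamma n w k * f k.+1 * (x ^+ k * (1 - x) ^+ (n.-1 - k)).
Proof.
move=> n_gt0; rewrite big_ord_recl /= mulr0 mul0r add0r mulr_sumr.
apply: eq_bigr => k _; rewrite /bump /= add1n.
have -> : (n - k.+1 = n.-1 - k)%N by rewrite subnS -!subn1 subnAC.
by rewrite exprS; ring.
Qed.

Lemma sum_bgamma (R : realType) (n : nat) (w : nat -> R) (f : nat -> R)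
    (x : R) : (1 <= n)%N ->
  \sum_(k < n.+1) f k * bgamma n w k * (x ^+ k * (1 - x) ^+ (n - k)) =
  (1 - x) * \sum_(k < n) bgamma n w k * f k * (x ^+ k * (1 - x) ^+ (n.-1 - k)).
Proof.
move=> n_gt0.
rewrite big_ord_recr /= bgamma_last // mulr0 mul0r addr0 mulr_sumr.
apply: eq_bigr => k _.
have -> : (n - k = (n.-1 - k).+1)%N.
  by case: n n_gt0 k => // n _ k /=; rewrite subSn // -ltnS.
by rewrite exprS; ring.
Qed.

(** Degree elevation: splitting each weight [gamma_k + gamma_{k-1}] returns from
    degree [n] to the degree [n-1] of [Q]. *)
Lemma rational_bernstein_split (R : realType) (n : nat) (Q : {poly R})
    (w : nat -> R) (f : R -> R) (x : R) : (1 <= n)%N ->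
  rational_bernstein n Q w f x =
  ((1 - x) * \sum_(k < n) bgamma n w k * f (bnode n w k)
                * (x ^+ k * (1 - x) ^+ (n.-1 - k))
   + x * \sum_(k < n) bgamma n w k * f (bnode n w k.+1)
                * (x ^+ k * (1 - x) ^+ (n.-1 - k))) / Q.[x].
Proof.
move=> n_gt0; rewrite -(sum_bgamma w (fun k => f (bnode n w k)) x n_gt0).
rewrite -(sum_bgamma_pred w (fun k => f (bnode n w k)) x n_gt0).
rewrite -big_split mulr_suml; apply: eq_bigr => k _ /=.
by rewrite [in LHS]mulrA -mulrDl mulrDr.
Qed.

Lemma rational_bernstein_mul_var (R : realType) (n : nat) (Q : {poly R})
    (w : nat -> R) (f : R -> R) (x : R) : (1 <= n)%N ->
  (forall j : nat, (j < n)%N -> 0 < w j) ->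
  rational_bernstein n Q w (fun t => t * f t) x =
  x * (\sum_(k < n) bgamma n w k * f (bnode n w k.+1)
          * (x ^+ k * (1 - x) ^+ (n.-1 - k))) / Q.[x].
Proof.
move=> n_gt0 wpos.
rewrite -(sum_bgamma_pred w (fun k => f (bnode n w k)) x n_gt0) mulr_suml.
apply: eq_bigr => k _ /=.
have weightE := bnode_weight n_gt0 wpos (ltn_ord k : (k <= n)%N).
by rewrite (mulrC (bnode n w k)) -[in LHS](mulrA (f _)) weightE [LHS]mulrA.
Qed.

(** Both operator values contain the sum over the right-hand nodes [x_{n,k+1}]:
    once with factor [x], once with factor [x^2].  The difference [x - x^2]
    is also, up to sign, the factor of the sum over the left-hand nodes, so only
    increments remain. *)
Lemma rational_bernstein_commutator (R : realType) (n : nat) (Q : {poly R})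
    (w : nat -> R) (f : R -> R) (x : R) : (1 <= n)%N ->
  (forall j : nat, (j < n)%N -> 0 < w j) ->
  rational_bernstein n Q w (fun t => t * f t) x
    - x * rational_bernstein n Q w f x =
  x * (1 - x) / Q.[x] *
    \sum_(k < n) bgamma n w k * (f (bnode n w k.+1) - f (bnode n w k))
      * (x ^+ k * (1 - x) ^+ (n.-1 - k)).
Proof.
move=> n_gt0 wpos.
rewrite rational_bernstein_mul_var // rational_bernstein_split //.
under [X in _ = _ * X]eq_bigr do rewrite mulrBr mulrBl.
by rewrite sumrB; ring.
Qed.

Lemma horner_bernstein_coefs (R : realType) (n : nat) (Q : {poly R})
    (w : nat -> R) (x : R) : bernstein_coefs n Q w ->
  Q.[x] = \sum_(k < n) bgamma n w k * (x ^+ k * (1 - x) ^+ (n.-1 - k)).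
Proof. by move=> ->; rewrite horner_sum; apply: eq_bigr => k _; rewrite !hornerE. Qed.

Lemma rational_bernstein_one (R : realType) (n : nat) (Q : {poly R})
    (w : nat -> R) (x : R) : (1 <= n)%N -> bernstein_coefs n Q w ->
  Q.[x] != 0 -> rational_bernstein n Q w (fun=> 1) x = 1.
Proof.
move=> n_gt0 hw Qx_neq0; rewrite rational_bernstein_split //.
under eq_bigr do rewrite mulr1.
by rewrite -(horner_bernstein_coefs x hw) -mulrDl subrK mul1r divff.
Qed.

(** Iterating the recurrence from [a 0 = 1] produces a last term [x^m * b 0],
    absent from the sum because [b 0 = 0]. *)
Lemma linear_recurrence_solution (R : pzRingType) (x : R) (a b : nat -> R) :
  a 0 = 1 -> (forall m, a m.+1 - x * a m = b m) -> b 0 = 0 ->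
  forall m, a m.+1 - x ^+ m.+1 = \sum_(0 <= l < m) x ^+ l * b (m - l)%N.
Proof.
move=> a0 aS b0; elim=> [|m IHm].
  by rewrite big_geq // expr1 -b0 -aS a0 mulr1.
rewrite big_nat_recl // expr0 mul1r subn0 -aS.
under eq_bigr do rewrite subSS exprS -mulrA.
by rewrite -mulr_sumr -IHm [in LHS]exprS mulrBr addrA subrK.
Qed.

Theorem theorem3 (R : realType) (n : nat) (hn : (1 <= n)%N)
  (Q : {poly R}) (hdeg : (size Q <= n)%N)
  (hQpos : forall t : R, 0 <= t <= 1 -> 0 < Q.[t])
  (w : nat -> R) (hw : bernstein_coefs n Q w)
  (hwpos : forall k : nat, (k < n)%N -> 0 < w k)
  (hW : property_W n w)
  (s : nat) (hs : (1 <= s)%N) (x : R) (hx : 0 <= x <= 1) :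
  rational_bernstein n Q w (fun t => t ^+ s) x - x ^+ s =
  x * (1 - x) / Q.[x] *
    \sum_(0 <= l < s.-1) x ^+ l *
      \sum_(k < n) bgamma n w k
        * (bnode n w k.+1 ^+ (s - 1 - l) - bnode n w k ^+ (s - 1 - l))
        * (x ^+ k * (1 - x) ^+ (n.-1 - k)).
Proof.
case: s hs => // m _; rewrite subn1 /=.
pose a j := rational_bernstein n Q w (fun t => t ^+ j) x.
pose b j := x * (1 - x) / Q.[x] * \sum_(k < n) bgamma n w k
  * (bnode n w k.+1 ^+ j - bnode n w k ^+ j) * (x ^+ k * (1 - x) ^+ (n.-1 - k)).
have a0 : a 0 = 1 by apply: rational_bernstein_one => //; rewrite gt_eqF ?hQpos.
have aS j : a j.+1 - x * a j = b j.
  rewrite -[RHS](rational_bernstein_commutator Q (fun t => t ^+ j) x hn hwpos).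
  congr (_ - _).
  by apply: eq_bigr => k _; rewrite exprS.
have b0 : b 0 = 0.
  by rewrite /b big1 ?mulr0 // => k _; rewrite subrr mulr0 mul0r.
rewrite [LHS](linear_recurrence_solution a0 aS b0) mulr_sumr.
by apply: eq_bigr => l _; rewrite mulrCA.
Qed.
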